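(* Let $n\ge 3$, let $M$ be an $n$-dimensional manifold with coordinates $(x^1,\dots,x^n)$ and induced tangent bundle coordinates $(x^i,y^i)$, let $f=f(x^1)$ be a positive smooth function whose derivative $f'$ is not identically zero, let $(c_{\lambda\mu})_{2\le\lambda,\mu\le n}$ be a non-singular symmetric matrix of real constants, and put $$\beta=f(x^1)\,y^1,\qquad \alpha=f(x^1)\sqrt{(y^1)^2+\varphi},\qquad \varphi=\sum_{\lambda,\mu=2}^n c_{\lambda\mu}y^\lambda y^\mu .$$ For a real constant $a$ consider $$F=\left((a+1)\beta+\sqrt{\alpha^2-\beta^2}\right)^{(1+a)/2}\left((a-1)\beta+\sqrt{\alpha^2-\beta^2}\right)^{(1-a)/2}.$$ If $a\neq 0,\pm1$, then $F$ is a (non-regular) Landsberg metric which is not Berwaldian, and the coefficients of its geodesic spray are $$G^1=\left(\frac{2f(x^1)^2(y^1)^2-\alpha^2}{2f(x^1)^2}+\frac{a^2-2}{2(a^2-1)}\,\frac{\alpha^2-\beta^2}{f(x^1)^2}\right)\frac{f'(x^1)}{f(x^1)},\qquad G^\mu=P\,y^\mu\quad(\mu=2,\dots,n),$$ where $$P=\left(y^1+\frac{a}{(a^2-1)f(x^1)}\sqrt{\alpha^2-\beta^2}\right)\frac{f'(x^1)}{f(x^1)}.$$ Moreover, when $a=0$ the metric is Riemannian (i.e. $F^2$ is a quadratic form in $y$, with non-degenerate metric tensor), and when $a=\pm1$ the metric is singular, i.e. $\det(g_{ij})=0$.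
   Context: Finsler metrics here are non-regular: $F=F(x,y)$ is a function, positively homogeneous of degree $1$ in $y$, considered only on the conic open subset of $TM\setminus\{0\}$ where its defining expression is defined, smooth and nonzero (in particular $\alpha^2-\beta^2>0$ and, for the real powers, the bases are positive), and whose metric tensor $g_{ij}=\frac12\frac{\partial^2F^2}{\partial y^i\partial y^j}$ is non-degenerate there; no definiteness is required (nor for the quadratic form $\alpha^2$). With $(g^{ij})$ the inverse of $(g_{ij})$, the geodesic spray of $F$ is $S=y^i\frac{\partial}{\partial x^i}-2G^i\frac{\partial}{\partial y^i}$ with coefficients $$G^i=\tfrac14 g^{ih}\left(y^r\frac{\partial^2F^2}{\partial x^r\partial y^h}-\frac{\partial F^2}{\partial x^h}\right).$$ The Berwald tensor is $G^h_{ijk}=\frac{\partial^3G^h}{\partial y^i\partial y^j\partial y^k}$ and the Landsberg tensor is $L_{ijk}=-\frac12F\,\ell_h\,G^h_{ijk}$, where $\ell_h=\frac{\partial F}{\partial y^h}$. $F$ is Landsberg if $L_{ijk}\equiv 0$ and Berwald (Berwaldian) if $G^h_{ijk}\equiv0$. Repeated indices are summed.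
   Formalization: The formal theorem additionally assumes that φ takes a positive value somewhere, i.e. that (c_{λμ}) is not negative definite; for negative definite c one never has α²−β²>0, so F is defined nowhere and ''not Berwaldian'' fails. *)

(* Defs.v *)
From HB Require Import structures.
From mathcomp Require Import all_boot all_order all_algebra.
From mathcomp Require Import all_classical all_reals all_analysis.

Set Implicit Arguments.
Unset Strict Implicit.
Unset Printing Implicit Defensive.

Import Order.TTheory GRing.Theory Num.Theory.
Import numFieldNormedType.Exports.

Local Open Scope classical_set_scope.
Local Open Scope ring_scope.

Section FinslerGeometry.
Context {R : realType} {n : nat}.

(* A pair p is a point of the tangent bundle: p.1 = (x^i) is the base point and
   p.2 = (y^i) the tangent vector. The index ord0 stands for the coordinate
   numbered 1 on paper. *)
Implicit Types (D : set ('rV[R]_n.+1 * 'rV[R]_n.+1))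
               (F : 'rV[R]_n.+1 * 'rV[R]_n.+1 -> R)
               (p : 'rV[R]_n.+1 * 'rV[R]_n.+1).

Definition dx (i : 'I_n.+1) F p : R := 'D_(delta_mx 0 i, 0) F p.
Definition dy (i : 'I_n.+1) F p : R := 'D_(0, delta_mx 0 i) F p.

(* C^oo on the (open) set D: all iterated directional derivatives, of every
   order (including 0) and in arbitrary directions of the (x, y) space, are
   differentiable at every point of D. *)
Definition smooth_on D F : Prop :=
  forall (vs : seq ('rV[R]_n.+1 * 'rV[R]_n.+1)) p, D p ->
    differentiable (foldr (fun v H => 'D_v H) F vs) p.

Definition sqr F p : R := F p ^+ 2.

Definition metric_tensor F p : 'M[R]_n.+1 :=
  \matrix_(i, j) (2^-1 * dy i (dy j (sqr F)) p).

Definition conic D : Prop :=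
  forall p (t : R), 0 < t -> D p -> D (p.1, t *: p.2).

(* A non-regular Finsler metric on D: no definiteness is required. *)
Definition finsler_metric D F : Prop :=
  [/\ [/\ open D, D !=set0, conic D & forall p, D p -> p.2 != 0],
      smooth_on D F,
      forall p (t : R), 0 < t -> D p -> F (p.1, t *: p.2) = t * F p,
      forall p, D p -> F p != 0
    & forall p, D p -> metric_tensor F p \in unitmx].

Definition spray F (i : 'I_n.+1) p : R :=
  4^-1 * \sum_h (invmx (metric_tensor F p) i h *
    (\sum_r (p.2 0 r * dx r (dy h (sqr F)) p) - dx h (sqr F) p)).

Definition berwald_tensor F (h i j k : 'I_n.+1) p : R :=
  dy i (dy j (dy k (spray F h))) p.

Definition landsberg_tensor F (i j k : 'I_n.+1) p : R :=
  - 2^-1 * F p * \sum_h (dy h F p * berwald_tensor F h i j k p).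

Definition landsberg D F : Prop :=
  forall p, D p -> forall i j k, landsberg_tensor F i j k p = 0.

Definition berwald D F : Prop :=
  forall p, D p -> forall h i j k, berwald_tensor F h i j k p = 0.

Definition riemannian D F : Prop :=
  finsler_metric D F /\
  exists q : 'rV[R]_n.+1 -> 'M[R]_n.+1,
    (forall x, (q x)^T = q x) /\
    forall p, D p -> F p ^+ 2 = \sum_i \sum_j q p.1 i j * p.2 0 i * p.2 0 j.

Definition singular D F : Prop :=
  forall p, D p -> \det (metric_tensor F p) = 0.

End FinslerGeometry.

Section AlphaBeta.
Context {R : realType} {n : nat}.
Variables (f : R -> R) (c : 'M[R]_n).

(* c : 'M_n carries the indices 2, ..., n.+1 of the paper: l : 'I_n stands for
   the coordinate lift ord0 l : 'I_n.+1. *)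
Definition phi (y : 'rV[R]_n.+1) : R :=
  \sum_l \sum_m c l m * y 0 (lift ord0 l) * y 0 (lift ord0 m).

Definition beta (p : 'rV[R]_n.+1 * 'rV[R]_n.+1) : R :=
  f (p.1 0 ord0) * p.2 0 ord0.

Definition alpha (p : 'rV[R]_n.+1 * 'rV[R]_n.+1) : R :=
  f (p.1 0 ord0) * Num.sqrt (p.2 0 ord0 ^+ 2 + phi p.2).

Definition radical (p : 'rV[R]_n.+1 * 'rV[R]_n.+1) : R :=
  Num.sqrt (alpha p ^+ 2 - beta p ^+ 2).

Variable a : R.

Definition F_ab (p : 'rV[R]_n.+1 * 'rV[R]_n.+1) : R :=
  ((a + 1) * beta p + radical p) `^ ((1 + a) / 2)
  * ((a - 1) * beta p + radical p) `^ ((1 - a) / 2).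

(* Num.sqrt is 0 on negative reals, so the condition beta^2 < alpha^2 also
   forces the radicand of alpha to be positive. *)
Definition dom_ab (U : set 'rV[R]_n.+1) : set ('rV[R]_n.+1 * 'rV[R]_n.+1) :=
  [set p | [/\ U p.1,
               0 < alpha p ^+ 2 - beta p ^+ 2,
               0 < (a + 1) * beta p + radical p
             & 0 < (a - 1) * beta p + radical p]].

Definition spray_P (p : 'rV[R]_n.+1 * 'rV[R]_n.+1) : R :=
  (p.2 0 ord0 + a / ((a ^+ 2 - 1) * f (p.1 0 ord0)) * radical p)
  * (derive1 f (p.1 0 ord0) / f (p.1 0 ord0)).

Definition spray_1 (p : 'rV[R]_n.+1 * 'rV[R]_n.+1) : R :=
  ((2 * f (p.1 0 ord0) ^+ 2 * p.2 0 ord0 ^+ 2 - alpha p ^+ 2)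
     / (2 * f (p.1 0 ord0) ^+ 2)
   + (a ^+ 2 - 2) / (2 * (a ^+ 2 - 1))
     * ((alpha p ^+ 2 - beta p ^+ 2) / f (p.1 0 ord0) ^+ 2))
  * (derive1 f (p.1 0 ord0) / f (p.1 0 ord0)).

End AlphaBeta.

(* Main.v *)
Require Import Defs.
From mathcomp Require Import all_boot all_order all_algebra.
From mathcomp Require Import all_classical all_reals all_analysis.
From mathcomp Require Import ring.
Import Order.TTheory GRing.Theory Num.Theory.
Import numFieldNormedType.Exports.
Local Open Scope classical_set_scope.
Local Open Scope ring_scope.

Set Implicit Arguments.
Unset Strict Implicit.
Unset Printing Implicit Defensive.

(** Write u = y^1, let q(y) be the half-gradient of phi (its k-th entry is half
    the partial derivative of phi along y^k, so its entry of index ord0 is 0)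
    and w = sqrt phi. On the domain the radical is f w, so with A = (a+1) u + w,
    B = (a-1) u + w, Q = A B = (a^2-1) u^2 + 2 a u w + w^2 and J = (A/B)^a,
    all powers collapse to F^2 = f^2 Q J. The logarithmic derivative of J is
    2 a (w du - u dw) / Q, which makes the gradient of F^2 linear in (u, w, q):
    d(F^2) = 2 f^2 J (((a^2-1) u + 2 a w) du + q) along the fibres. All the
    algebra below rests on this.

    Differentiating once more, g = f^2 J M, where M (the matrix [core]) is the
    form c plus a correction supported on the span of du and q. On that plane M
    acts as a 2 x 2 matrix of determinant a^2 - 1. As c is non-singular, M is
    invertible when a is not 1 or -1 ([core_unit]), while for a = 1 or -1 the
    vector with components w and - 2 a y^m (m > 1) spans a kernel
    ([metric_singular]).

    The spray equation is therefore equivalent to one linear system, and it is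
    enough to check that the expected coefficients solve it
    ([spray_row_metric]). They are G^1 = (f'/f) (u^2 - phi/(a^2-1)) / 2, which
    is quadratic in y, and G^m = (f'/f) (u + kappa w) y^m with
    kappa = a/(a^2-1). So the only third derivatives that survive are those of
    w y^m, scaled by kappa f'/f. Since F dF/dy^m = f^2 J q_m for m > 1, the
    Landsberg tensor is proportional to the contraction of d^3(w y^m) with
    q = w dw, which is w/2 times the third derivative of w^2 = phi and vanishes
    because phi is quadratic ([contraction_berwald]). The Berwald tensor itself
    is not zero: its trace over the upper index and one lower index is a nonzero
    multiple of the Hessian of w ([trace_berwald]), and if that vanished, phi c
    would be the product of q with itself, so c would have rank 1, whereas its
    rank is at least 2.

    For a = 0 one has J = 1 and F^2 = f^2 (phi - u^2).

    Smoothness is handled by a syntactic class of functions closed under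
    directional derivatives ([elementary]). *)

(** * Directional derivatives of real functions *)

Section Calculus.
Context {R : realType} {V : normedModType R}.
Implicit Types (F G : V -> R) (p v : V) (D : set V).

(** The zero map satisfies the first-order expansion that characterizes the
    differential. *)
Lemma near0_differentiable F p :
  (\near p, F p = 0) -> differentiable F p.
Proof.
move=> F0.
pose Z : {linear V -> R} := @GRing.null_fun V R.
have E : F \o shift p = cst (F p) + Z +o_ (0 : V) id.
  apply/eqaddoP => e e0; rewrite (nbhs_singleton F0).
  have : \forall h \near (0 : V), F (h + p) = 0.
    by move: F0; rewrite (near_shift 0 p) /=; apply: filterS => h; rewrite subr0.
  apply: filterS => h /= Fh; rewrite /shift /= !fctE /= Fh.
  by rewrite addr0 subr0 normr0 mulr_ge0 // ltW.
have C : continuous Z by move=> x; exact: cst_continuous.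
have dE := diff_unique C E.
by apply/diff_locallyP; rewrite dE.
Qed.

(** Differentiability is a local property: the difference of the two functions
    vanishes near the point. *)
Lemma near_eq_differentiable F G p :
  (\near p, F p = G p) -> differentiable F p -> differentiable G p.
Proof.
move=> FG dF; rewrite (_ : G = F + (G - F)); last first.
  by apply/funext => q; rewrite !fctE addrC subrK.
apply: differentiableD => //; apply: near0_differentiable.
by apply: filterS FG => q; rewrite !fctE => ->; rewrite subrr.
Qed.

Lemma open_eq_near D F G p : open D -> {in D, F =1 G} -> D p ->
  \near p, F p = G p.
Proof.
move=> oD FG Dp; have : \near p, D p by exact: open_nbhs_nbhs.
by apply: filterS => q Dq; apply: FG; rewrite inE.
Qed.

Lemma open_eq_derive D F G v : open D -> {in D, F =1 G} ->
  {in D, 'D_v F =1 'D_v G}.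
Proof.
move=> oD FG p; rewrite inE => Dp.
exact/near_eq_derive/(open_eq_near oD FG Dp).
Qed.

(** The rules are stated for explicit functions of the point rather than for
    sums and products in the ring of functions, so that [derive_rules] can apply
    them to formulas as they stand. *)
Lemma is_derive_cstE (a : R) p v : is_derive p v (fun=> a) 0.
Proof. exact: is_derive_cst. Qed.

Lemma is_deriveDE F G p v (dF dG : R) :
  is_derive p v F dF -> is_derive p v G dG ->
  is_derive p v (fun q => F q + G q) (dF + dG).
Proof. by move=> ? ?; apply: is_deriveD. Qed.

Lemma is_deriveME F G p v (dF dG : R) :
  is_derive p v F dF -> is_derive p v G dG ->
  is_derive p v (fun q => F q * G q) (dF * G p + F p * dG).
Proof.
move=> ? ?; rewrite addrC [dF * _]mulrC.
exact: (is_deriveM (f:=F) (g:=G)).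
Qed.

End Calculus.

Section ChainRule.
Context {R : realType} {V : normedModType R}.
Implicit Types (F G : V -> R) (p v : V) (D : set V).

(** Restricting to a line reduces the chain rule below to one real variable:
    derivability of F along the single direction v is then enough. *)
Lemma is_derive_line F p v (d : R) :
  is_derive p v F d <-> is_derive (0 : R) 1 (fun t : R => F (t *: v + p)) d.
Proof.
have E : 'D_v F p = 'D_(1 : R) (fun t : R => F (t *: v + p)) 0.
  rewrite /derive; set g1 := fun h => h^-1 *: _; set g2 := fun h => h^-1 *: _.
  suff -> : g1 = g2 by [].
  by apply/funext => t; rewrite /g1 /g2 /= addr0 scale0r add0r [t%:A]mulr1.
split=> -[dG <-].
  by apply: DeriveDef; [exact: (iffLR (derivable1P F p v))|rewrite E].
by apply: DeriveDef; [exact: (iffRL (derivable1P F p v))|rewrite E].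
Qed.

Lemma is_derive_compE (h : R -> R) F p v (dh dF : R) :
  is_derive (F p) 1 h dh -> is_derive p v F dF ->
  is_derive p v (fun q => h (F q)) (dh * dF).
Proof.
move=> hh /is_derive_line hF; apply/is_derive_line.
apply: (@is_derive1_comp _ h (fun t : R => F (t *: v + p))) => //.
by rewrite scale0r add0r.
Qed.

Lemma is_derive_linear (L : V -> R) p v : linear L -> is_derive p v L (L v).
Proof.
move=> linL; apply/is_derive_line; rewrite (_ : (fun _ => _) = fun t => t * L v + L p).
  have Hid : is_derive (0 : R) 1 (id : R -> R) (1 : R) by exact: is_derive_id.
  have H := is_deriveDE (is_deriveME Hid (is_derive_cstE (L v) (0 : R) 1))
    (is_derive_cstE (L p) (0 : R) 1).
  by apply: (is_derive_eq H); rewrite mul1r mulr0 !addr0.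
by apply/funext => t; rewrite linL.
Qed.

End ChainRule.

Lemma is_derive_sumE (R : realType) (V : normedModType R) m (F : 'I_m -> V -> R)
    (p v : V) (dF : 'I_m -> R) :
  (forall i, is_derive p v (F i) (dF i)) ->
  is_derive p v (fun q => \sum_i F i q) (\sum_i dF i).
Proof.
move=> H; rewrite (_ : (fun _ => _) = \sum_i F i); first exact: is_derive_sum.
by apply/funext => q; rewrite fct_sumE.
Qed.

Lemma is_deriveVE (R : realType) (V : normedModType R) (F : V -> R)
    (p v : V) (dF : R) :
  F p != 0 -> is_derive p v F dF ->
  is_derive p v (fun q => (F q)^-1) (- dF / F p ^+ 2).
Proof.
move=> F0 hF; have hV := is_deriveV F0 (is_derive_id (F p) (1 : R)).
have := is_derive_compE (h := fun y => y^-1) hV hF.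
by move=> H; apply: (is_derive_eq H); rewrite /= [_%:A]mulr1 mulNr mulNr mulrC.
Qed.

Lemma is_derive_powRE (R : realType) (x a : R) : 0 < x ->
  is_derive x 1 (fun y => y `^ a) (a * x `^ a / x).
Proof.
move=> x0; apply: is_derive_eq; first exact: is_derive1_powR.
rewrite powRD; last by rewrite lt0r_neq0 ?implybT.
by rewrite powR_inv1 ?ltW // mulrA.
Qed.

Lemma is_derive_sqrE (R : realType) (V : normedModType R) (F : V -> R)
    (p v : V) (dF : R) :
  is_derive p v F dF -> is_derive p v (fun q => F q ^+ 2) (2 * F p * dF).
Proof.
move=> hF; apply: (is_derive_eq (is_deriveME hF hF)).
by ring.
Qed.

(** Factors that depend on the base point only are constants for the fibre
    derivatives. *)
Lemma is_derive_base (R : realType) (V W : normedModType R) (g : V -> R)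
    (p : V * W) (z : W) :
  is_derive p (0, z) (fun q => g q.1) 0.
Proof.
apply/is_derive_line; rewrite (_ : (fun _ => _) = fun=> g p.1).
  exact: is_derive_cstE.
by apply/funext => t /=; rewrite scaler0 add0r.
Qed.

Lemma is_deriveNE (R : realType) (V : normedModType R) (F : V -> R)
    (p v : V) (dF : R) :
  is_derive p v F dF -> is_derive p v (fun q => - F q) (- dF).
Proof. by move=> hF; exact: is_deriveN. Qed.

(** Derives a formula structurally, taking the derivatives of its leaves from the
    context, and leaves the equality of the two values of the derivative. Class
    resolution is bypassed: it would split off scalar multiples and produce
    values in which [*:] hides products from [ring]. *)
Ltac derive_rules :=
  notypeclasses refine (is_derive_eq _ _);
  [ repeat (first [ eassumption
                  | notypeclasses refine (is_derive_cstE _ _ _)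
                  | notypeclasses refine (is_derive_sqrE _)
                  | notypeclasses refine (is_deriveNE _)
                  | notypeclasses refine (is_deriveME _ _)
                  | notypeclasses refine (is_deriveDE _ _) ]) | cbv beta ].

(** * A class of smooth functions closed under differentiation *)

Section Elementary.
Context {R : realType} {n : nat}.
Local Notation V := ('rV[R]_n.+1 * 'rV[R]_n.+1)%type.
Implicit Types (F G : V -> R) (p v : V) (D : set V).

(** In the composition rule the outer function belongs to a family [h] indexed
    by [I] whose derivatives, up to a constant factor, stay in the family. This
    covers real powers (index: the exponent) and the iterated derivatives of a
    given smooth function (index: the order) in the same way. *)
Inductive elementary D : (V -> R) -> Prop :=
| elementary_cst a : elementary D (fun=> a)
| elementary_x i : elementary D (fun p => p.1 0 i)
| elementary_y i : elementary D (fun p => p.2 0 i)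
| elementaryD F G : elementary D F -> elementary D G ->
    elementary D (fun p => F p + G p)
| elementaryM F G : elementary D F -> elementary D G ->
    elementary D (fun p => F p * G p)
| elementary_comp (I : Type) (h : I -> R -> R) (c : I -> R) (s : I -> I) F t :
    elementary D F ->
    (forall i p, D p -> is_derive (F p) 1 (h i) (c i * h (s i) (F p))) ->
    elementary D (fun p => h t (F p))
| elementary_eq F G : elementary D F -> {in D, F =1 G} -> elementary D G.

Lemma is_derive_x i p v : is_derive p v (fun q : V => q.1 0 i) (v.1 0 i).
Proof. by apply: is_derive_linear => a q r; rewrite /= !mxE. Qed.

Lemma is_derive_y i p v : is_derive p v (fun q : V => q.2 0 i) (v.2 0 i).
Proof. by apply: is_derive_linear => a q r; rewrite /= !mxE. Qed.

Lemma elementary_differentiable D F p : open D -> elementary D F -> D p ->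
  differentiable F p.
Proof.
move=> oD; elim=> {F} [a _|i _|i _|F G _ dF _ dG Dp|F G _ dF _ dG Dp|
  I h c s F t _ dF hh Dp|F G _ dF FG Dp].
- exact: differentiable_cst.
- apply: (@differentiable_comp _ _ _ _ fst (fun N : 'rV[R]_n.+1 => N 0 i)).
    by apply: linear_differentiable; move=> q; exact: cvg_fst.
  exact: differentiable_coord.
- apply: (@differentiable_comp _ _ _ _ snd (fun N : 'rV[R]_n.+1 => N 0 i)).
    by apply: linear_differentiable; move=> q; exact: cvg_snd.
  exact: differentiable_coord.
- exact: (differentiableD (dF Dp) (dG Dp)).
- exact: (differentiableM (dF Dp) (dG Dp)).
- apply: differentiable_comp; first exact: dF.
  by apply/derivable1_diffP; case: (hh t p Dp).
- by apply: near_eq_differentiable (dF Dp); exact: open_eq_near FG Dp.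
Qed.

(** The derivation follows the rules one by one; off D nothing is known of F, so
    the comparison is made on D only. *)
Lemma elementary_derive D F v : open D -> elementary D F ->
  exists2 G, elementary D G & {in D, 'D_v F =1 G}.
Proof.
move=> oD; elim=> {F} [a|i|i|F G eF [F' eF' dF] eG [G' eG' dG]|
  F G eF [F' eF' dF] eG [G' eG' dG]|I h c s F t eF [F' eF' dF] hh|
  F G eF [F' eF' dF] FG].
- exists (fun=> 0); first exact: elementary_cst.
  by move=> p _; exact: derive_val.
- exists (fun=> v.1 0 i); first exact: elementary_cst.
  by move=> p _; apply: derive_val; exact: is_derive_x.
- exists (fun=> v.2 0 i); first exact: elementary_cst.
  by move=> p _; apply: derive_val; exact: is_derive_y.
- exists (fun p => F' p + G' p); first exact: elementaryD.
  move=> p Dp; rewrite -dF // -dG //; apply: derive_val.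
  move: Dp; rewrite inE => Dp.
  by apply: is_deriveDE; apply/derivableP/diff_derivable/elementary_differentiable;
    [exact: oD|exact: eF|by []|exact: oD|exact: eG|by []].
- exists (fun p => F' p * G p + F p * G' p).
    by apply: elementaryD; apply: elementaryM.
  move=> p Dp; rewrite -dF // -dG //; apply: derive_val.
  move: Dp; rewrite inE => Dp.
  by apply: is_deriveME; apply/derivableP/diff_derivable/elementary_differentiable;
    [exact: oD|exact: eF|by []|exact: oD|exact: eG|by []].
- exists (fun p => c t * h (s t) (F p) * F' p).
    apply: elementaryM => //; apply: elementaryM; first exact: elementary_cst.
    exact: (elementary_comp (s t) eF hh).
  move=> p Dp; rewrite -dF //; apply: derive_val.
  move: Dp; rewrite inE => Dp; apply: is_derive_compE; first exact: hh.
  by apply/derivableP/diff_derivable/elementary_differentiable;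
    [exact: oD|exact: eF|].
- exists F' => // p Dp; rewrite -dF //.
  by apply: esym; apply: (open_eq_derive v oD FG).
Qed.

(** By induction on the list of directions, every iterated derivative agrees on
    the open set D with an elementary function, hence is differentiable there. *)
Lemma elementary_smooth D F : open D -> elementary D F -> smooth_on D F.
Proof.
move=> oD eF vs.
suff [G eG FG] : exists2 G, elementary D G &
    {in D, foldr (fun v H => 'D_v H) F vs =1 G}.
  move=> p Dp; apply: near_eq_differentiable (elementary_differentiable oD eG Dp).
  by apply: (open_eq_near oD _ Dp) => q Dq; rewrite FG.
elim: vs => [|v vs [G eG FG]] /=; first by exists F.
have [G' eG' GG'] := elementary_derive v oD eG.
exists G' => // p Dp; rewrite -GG' //.
exact: (open_eq_derive v oD FG).
Qed.

End Elementary.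

Lemma elementary_sum (R : realType) n (D : set ('rV[R]_n.+1 * 'rV[R]_n.+1)) m
    (F : 'I_m -> 'rV[R]_n.+1 * 'rV[R]_n.+1 -> R) :
  (forall i, elementary D (F i)) -> elementary D (fun p => \sum_i F i p).
Proof.
move=> eF; rewrite (_ : (fun _ => _) = (fun p => \sum_(i <- index_enum 'I_m) F i p))//.
elim: (index_enum _) => [|i r IH].
  by apply: elementary_eq (elementary_cst D 0) _ => p _; rewrite big_nil.
by apply: elementary_eq (elementaryD (eF i) IH) _ => p _; rewrite big_cons.
Qed.

Lemma elementary_powR (R : realType) n (D : set ('rV[R]_n.+1 * 'rV[R]_n.+1))
    (F : 'rV[R]_n.+1 * 'rV[R]_n.+1 -> R) (r : R) : elementary D F ->
  (forall p, D p -> 0 < F p) -> elementary D (fun p => F p `^ r).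
Proof.
move=> eF Fpos; apply: (@elementary_comp _ _ D R (fun s x => x `^ s) id (fun s => s - 1)) => //.
by move=> s p Dp; exact/is_derive1_powR/Fpos.
Qed.

(** * The quadratic form phi and its square root *)

Lemma phi_lift (R : realType) n (c : 'M[R]_n) (y z : 'rV[R]_n.+1) :
  (forall l, y 0 (lift ord0 l) = z 0 (lift ord0 l)) -> phi c y = phi c z.
Proof.
move=> yz; rewrite /phi; apply: eq_bigr => l _; apply: eq_bigr => m _.
by rewrite !yz.
Qed.

Lemma phiZ (R : realType) n (c : 'M[R]_n) (t : R) (y : 'rV[R]_n.+1) :
  phi c (t *: y) = t ^+ 2 * phi c y.
Proof.
rewrite /phi big_distrr; apply: eq_bigr => l _; rewrite big_distrr.
by apply: eq_bigr => m _ /=; rewrite !mxE; ring.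
Qed.

Section Form.
Context {R : realType} {n : nat}.
Variable c : 'M[R]_n.
Local Notation V := ('rV[R]_n.+1 * 'rV[R]_n.+1)%type.
Implicit Types (y z : 'rV[R]_n.+1) (p v : V).

(** Extending c by zeros to the coordinate ord0 lets all indices range over the
    same type, so that derivatives can be computed without separating ord0 from
    the other coordinates. *)
Definition ext_form : 'M[R]_n.+1 := \matrix_(i, j)
  if unlift ord0 i is Some l then
    if unlift ord0 j is Some m then c l m else 0 else 0.

Definition half_grad y : 'rV[R]_n.+1 := y *m ext_form.
Local Notation q := half_grad.

Lemma ext_form0l j : ext_form ord0 j = 0.
Proof. by rewrite mxE unlift_none. Qed.

Lemma ext_form0r i : ext_form i ord0 = 0.
Proof. by rewrite mxE unlift_none; case: unlift. Qed.

Lemma ext_formE l m : ext_form (lift ord0 l) (lift ord0 m) = c l m.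
Proof. by rewrite mxE !liftK. Qed.

Lemma half_grad0 y : q y 0 ord0 = 0.
Proof. by rewrite mxE big1 // => i _; rewrite ext_form0r mulr0. Qed.

Lemma half_grad_lift y l :
  q y 0 (lift ord0 l) = \sum_m y 0 (lift ord0 m) * c m l.
Proof.
rewrite mxE big_ord_recl ext_form0l mulr0 add0r.
by apply: eq_bigr => m _; rewrite ext_formE.
Qed.

Lemma sum_half_grad y z :
  \sum_i q y 0 i * z 0 i = \sum_l q y 0 (lift ord0 l) * z 0 (lift ord0 l).
Proof. by rewrite big_ord_recl half_grad0 mul0r add0r. Qed.

Hypothesis csym : c^T = c.

Lemma ext_form_sym i j : ext_form i j = ext_form j i.
Proof.
case: (unliftP ord0 i) => [l ->|->]; last by rewrite ext_form0l ext_form0r.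
case: (unliftP ord0 j) => [m ->|->]; last by rewrite ext_form0l ext_form0r.
by rewrite !ext_formE -{1}csym mxE.
Qed.

Lemma half_gradC y z : \sum_i q y 0 i * z 0 i = \sum_i q z 0 i * y 0 i.
Proof.
under eq_bigr do rewrite mxE big_distrl.
rewrite exchange_big; apply: eq_bigr => i _ /=; rewrite mxE big_distrl.
by apply: eq_bigr => j _ /=; rewrite (ext_form_sym i j); ring.
Qed.

Lemma phi_half_grad y : phi c y = \sum_i q y 0 i * y 0 i.
Proof.
rewrite sum_half_grad /phi; apply: eq_bigr => l _.
rewrite half_grad_lift big_distrl; apply: eq_bigr => m _ /=.
by rewrite -{1}csym mxE; ring.
Qed.

(** [half_grad] is linear, hence its own derivative. *)
Lemma is_derive_half_grad i p v :
  is_derive p v (fun r : V => q r.2 0 i) (q v.2 0 i).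
Proof.
apply: (is_derive_linear (L := fun r : V => q r.2 0 i)) => a r s.
by rewrite /= /half_grad mulmxDl -scalemxAl !mxE.
Qed.

Lemma is_derive_phi p v :
  is_derive p v (fun r : V => phi c r.2) (2 * \sum_i q p.2 0 i * v.2 0 i).
Proof.
rewrite (_ : (fun _ => _) = fun r : V => \sum_i q r.2 0 i * r.2 0 i); last first.
  by apply/funext => r; rewrite phi_half_grad.
have H := is_derive_sumE (fun i => is_deriveME (is_derive_half_grad i p v)
  (is_derive_y i p v)).
by apply: (is_derive_eq H); rewrite big_split /= half_gradC mulr2n mulrDl mul1r.
Qed.

Definition rho p : R := Num.sqrt (phi c p.2).

Lemma is_derive_rho p v : 0 < phi c p.2 ->
  is_derive p v rho ((\sum_i q p.2 0 i * v.2 0 i) / rho p).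
Proof.
move=> phi0; have H := is_derive_compE (F := fun r : V => phi c r.2)
  (is_derive1_sqrt phi0) (is_derive_phi p v).
apply: (is_derive_eq H); rewrite -/(rho p).
have : rho p != 0 by rewrite sqrtr_eq0 -ltNge.
by move=> r0; field.
Qed.

Lemma elementary_phi (D : set V) : elementary D (fun p => phi c p.2).
Proof.
apply: elementary_sum => l; apply: elementary_sum => m.
by repeat (apply: elementaryM; last exact: elementary_y); exact: elementary_cst.
Qed.

(** The square root is the power 1/2, but only where phi is nonnegative. *)
Lemma elementary_rho (D : set V) : (forall p, D p -> 0 < phi c p.2) ->
  elementary D rho.
Proof.
move=> phi0; apply: elementary_eq (elementary_powR (2^-1) (elementary_phi D) phi0) _.
by move=> p; rewrite inE => Dp; rewrite /rho powR12_sqrt // ltW // phi0.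
Qed.

End Form.

(** * The metric and its fundamental tensor *)

Section Metric.
Context {R : realType} {n : nat}.
Variables (f : R -> R) (c : 'M[R]_n) (a : R) (U : set 'rV[R]_n.+1).
Hypothesis csym : c^T = c.
Local Notation V := ('rV[R]_n.+1 * 'rV[R]_n.+1)%type.
Implicit Types (y z : 'rV[R]_n.+1) (p v : V).

Hypothesis hU : open U.
Hypothesis fsmooth : forall x : 'rV[R]_n.+1, U x ->
       forall k : nat, derivable (derive1n k f) (x 0 ord0) 1.
Hypothesis fpos : forall x : 'rV[R]_n.+1, U x -> 0 < f (x 0 ord0).

Local Notation q := (half_grad c).
Local Notation C := (ext_form c).
Local Notation w := (rho c).
Local Notation D := (dom_ab f c a U).
Local Notation F := (F_ab f c a).
Local Notation u p := (p.2 0 ord0).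
Local Notation X p := (p.1 0 ord0).
Local Notation delta i j := ((i == j)%:R : R).

(** For k = a + 1 and k = a - 1 these are the bases of the two powers in F,
    divided by f. *)
Definition factor (k : R) p : R := k * u p + w p.
Local Notation A := (factor (a + 1)).
Local Notation B := (factor (a - 1)).

Definition quad p : R := (a ^+ 2 - 1) * u p ^+ 2 + 2 * a * (u p * w p) + w p ^+ 2.

Definition ratio p : R := A p `^ a * B p `^ (- a).
Local Notation Q := quad.
Local Notation J := ratio.

Lemma alphabeta_phi p : U p.1 -> 0 < phi c p.2 ->
  alpha f c p ^+ 2 - beta f p ^+ 2 = f (X p) ^+ 2 * phi c p.2.
Proof.
move=> Up phi0; rewrite /alpha /beta exprMn sqr_sqrtr; first by ring.
by rewrite addr_ge0 ?sqr_ge0 // ltW.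
Qed.

Lemma radicalE p : U p.1 -> 0 < phi c p.2 -> radical f c p = f (X p) * w p.
Proof.
move=> Up phi0; rewrite /radical alphabeta_phi // sqrtrM ?sqr_ge0 //.
by rewrite sqrtr_sqr gtr0_norm // fpos.
Qed.

(** In this form the domain depends on f only through U, and openness and
    conicity are visible. *)
Lemma dom_abE p : D p <->
  [/\ U p.1, 0 < phi c p.2, 0 < A p & 0 < B p].
Proof.
have key k : U p.1 -> 0 < phi c p.2 ->
    (0 < k * beta f p + radical f c p) = (0 < factor k p).
  move=> Up phi0; rewrite radicalE // /beta /factor mulrCA -mulrDr.
  by rewrite pmulr_rgt0 // fpos.
split=> [[Up ab Ap Bp]|[Up phi0 Ap Bp]].
  suff phi0 : 0 < phi c p.2 by rewrite -!key.
  have f0 : 0 < f (X p) by exact: fpos.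
  move: ab; rewrite /alpha /beta.
  have [ge0|lt0] := leP 0 (u p ^+ 2 + phi c p.2).
    rewrite exprMn sqr_sqrtr // exprMn -mulrBr addrAC subrr add0r.
    by rewrite pmulr_rgt0 // exprn_gt0.
  (* Where u^2 + phi < 0, alpha is 0 and alpha^2 - beta^2 cannot be positive. *)
  rewrite ler0_sqrtr ?ltW // mulr0 expr0n /= sub0r oppr_gt0.
  by rewrite ltNge sqr_ge0.
split=> //; rewrite ?key //.
by rewrite alphabeta_phi // mulr_gt0 // exprn_gt0 // fpos.
Qed.

Lemma dom_pos p : D p -> [/\ 0 < f (X p), 0 < w p, 0 < A p & 0 < B p].
Proof.
by move=> /dom_abE[Up phi0 Ap Bp]; split=> //; [exact: fpos|rewrite sqrtr_gt0].
Qed.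

Lemma quadE p : Q p = A p * B p.
Proof. by rewrite /quad /factor; ring. Qed.

Lemma quad_gt0 p : D p -> 0 < Q p.
Proof. by move=> /dom_pos[_ _ Ap Bp]; rewrite quadE mulr_gt0. Qed.

Lemma ratio_gt0 p : D p -> 0 < J p.
Proof. by move=> /dom_pos[_ _ Ap Bp]; rewrite mulr_gt0 // powR_gt0. Qed.

Lemma rho_sqr p : D p -> w p ^+ 2 = phi c p.2.
Proof. by move=> /dom_abE[_ phi0 _ _]; rewrite sqr_sqrtr // ltW. Qed.

(** The two exponents add up to 1, so a single factor f comes out. *)
Lemma F_abE p : D p ->
  F p = f (X p) * (A p `^ ((1 + a) / 2) * B p `^ ((1 - a) / 2)).
Proof.
move=> Dp; have [f0 w0 Ap Bp] := dom_pos Dp.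
have [Up phi0 _ _] := (dom_abE p).1 Dp.
have E k : k * beta f p + radical f c p = f (X p) * factor k p.
  by rewrite radicalE // /beta /factor; ring.
rewrite /F_ab !E !powRM ?ltW // mulrACA -powRD; last by rewrite lt0r_neq0 ?implybT.
rewrite (_ : (1 + a) / 2 + (1 - a) / 2 = 1); last by field.
by rewrite powRr1 // ltW.
Qed.

Lemma sqr_F_abE p : D p -> sqr F p = f (X p) ^+ 2 * (Q p * J p).
Proof.
move=> Dp; have [f0 w0 Ap Bp] := dom_pos Dp.
have E x s : 0 < x -> (x `^ (s / 2)) ^+ 2 = x `^ s.
  by move=> x0; rewrite -powR_mulrn ?powR_ge0 // -powRrM divfK // pnatr_eq0.
rewrite /sqr F_abE // !exprMn !E // quadE /ratio.
rewrite !powRD ?lt0r_neq0 ?implybT // !powRr1 ?ltW //.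
by ring.
Qed.

Lemma rho_continuous : continuous w.
Proof.
move=> r; rewrite /rho; apply: (continuous_comp (f := fun s : V => phi c s.2)).
  apply: differentiable_continuous.
  exact: (elementary_differentiable openT (elementary_phi c setT) I).
exact: sqrt_continuous.
Qed.

Lemma factor_continuous k : continuous (factor k).
Proof.
move=> r; apply: (@continuousD _ _ _ (fun s : V => k * u s) w r); last exact: rho_continuous.
apply: differentiable_continuous.
exact: (elementary_differentiable openT (elementaryM (elementary_cst setT k)
  (elementary_y _ ord0)) I).
Qed.

Lemma dom_ab_open : open D.
Proof.
rewrite (_ : D = [set p | U p.1] `&` (w @^-1` [set x | 0 < x])
  `&` (A @^-1` [set x | 0 < x]) `&` (B @^-1` [set x | 0 < x])); last first.
  apply/seteqP; split=> r.
    move=> Dr; have [_ w0 Ar Br] := dom_pos Dr.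
    by have [Ur _ _ _] := (dom_abE r).1 Dr.
  move=> [[[Ur w0] Ar] Br]; apply/dom_abE; split=> //.
  by rewrite -sqrtr_gt0.
have cont (g : V -> R) : continuous g -> open (g @^-1` [set x | 0 < x] : set V).
  by move=> cg; apply: open_comp => [r _|]; [exact: cg|exact: open_gt].
repeat apply: openI; [|apply: cont; exact: rho_continuous
  |apply: cont; exact: factor_continuous|apply: cont; exact: factor_continuous].
by apply: (open_comp (f := fst)) => // r _; exact: cvg_fst.
Qed.

Section AtPoint.
Variable p : V.
Hypothesis Dp : D p.

Lemma is_derive_u v : is_derive p v (fun r : V => u r) (u v).
Proof. exact: is_derive_y. Qed.

Local Notation Dq v := (\sum_i q p.2 0 i * v.2 0 i).

Lemma is_derive_w v : is_derive p v w (Dq v / w p).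
Proof. by apply: is_derive_rho => //; have [_ ] := (dom_abE p).1 Dp. Qed.

(** The derivative of A/B is a combination of w du - u dw alone, because A and B
    are homogeneous of degree 1 in (u, w). *)
Lemma is_derive_ratio v : is_derive p v J
  (2 * a * J p / Q p * (w p * u v - u p * (Dq v / w p))).
Proof.
have [f0 w0 Ap Bp] := dom_pos Dp.
have Hu := is_derive_u v; have Hw := is_derive_w v.
have HA k : is_derive p v (factor k) (k * u v + Dq v / w p).
  by rewrite /factor; derive_rules; rewrite /=; ring.
have H k s : 0 < factor k p -> is_derive p v (fun r => factor k r `^ s)
    (s * factor k p `^ s / factor k p * (k * u v + Dq v / w p)).
  move=> k0; exact: (is_derive_compE (is_derive_powRE s k0) (HA k)).
have H1 := H _ a Ap; have H2 := H _ (- a) Bp.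
rewrite /ratio; derive_rules; rewrite quadE.
(* Both sides are rewritten over A and B, the only denominators left. *)
rewrite (_ : u p = (A p - B p) / 2); last by rewrite /factor; field.
rewrite (_ : w p * u v = ((a + 1) * B p - (a - 1) * A p) / 2 * u v); last first.
  by rewrite /factor; field.
field; rewrite ?lt0r_neq0 //.
Qed.

Lemma is_derive_quad v : is_derive p v Q
  (2 * ((a ^+ 2 - 1) * u p + a * w p) * u v + 2 * (a * u p + w p) * (Dq v / w p)).
Proof.
have Hu := is_derive_u v; have Hw := is_derive_w v.
by rewrite /quad; derive_rules; rewrite /=; ring.
Qed.

Lemma is_derive_f v : is_derive p v (fun r : V => f (X r)) (derive1 f (X p) * X v).
Proof.
have [Up _ _ _] := (dom_abE p).1 Dp.
apply: (is_derive_compE (F := fun r : V => X r)); last exact: is_derive_x.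
by rewrite derive1E; apply: derivableP; exact: (@fsmooth _ Up 0%N).
Qed.

(** The denominator Q of the derivative of J cancels against the factor Q of
    F^2; this is where the simple form of the gradient comes from. *)
Lemma is_derive_sqr_F v : is_derive p v (sqr F)
  (2 * f (X p) * J p * (derive1 f (X p) * X v * Q p +
     f (X p) * (((a ^+ 2 - 1) * u p + 2 * a * w p) * u v + Dq v))).
Proof.
have E : \forall r \near p, f (X (r : V)) ^+ 2 * (Q r * J r) = sqr F r.
  apply: (open_eq_near dom_ab_open) => // r; rewrite inE => Dr.
  by rewrite sqr_F_abE.
apply: (near_eq_is_derive E).
have Hf := is_derive_f v; have HQ := is_derive_quad v.
have HJ := is_derive_ratio v.
have [f0 w0 Ap Bp] := dom_pos Dp; have Q0 := quad_gt0 Dp.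
derive_rules.
field; rewrite ?lt0r_neq0 //.
Qed.

Lemma Dq_dy i : Dq ((0, delta_mx 0 i) : V) = q p.2 0 i.
Proof.
rewrite (bigD1 i) //= big1 => [|j ji]; first by rewrite [delta_mx _ _ _ _]mxE !eqxx mulr1 addr0.
by rewrite [delta_mx _ _ _ _]mxE eqxx (negbTE ji) mulr0.
Qed.

Lemma u_dy i : u ((0, delta_mx 0 i) : V) = delta i ord0.
Proof. by rewrite /= mxE eqxx eq_sym. Qed.

End AtPoint.

Lemma dy_sqr_F j : {in D, dy j (sqr F) =1 fun p => 2 * f (X p) ^+ 2 * (J p *
   (((a ^+ 2 - 1) * u p + 2 * a * w p) * delta j ord0 + q p.2 0 j))}.
Proof.
move=> p; rewrite inE => Dp; rewrite /dy.
have := is_derive_sqr_F Dp (0, delta_mx 0 j).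
rewrite Dq_dy u_dy /= [Y in _ * Y * Q p]mxE mulr0 mul0r add0r => H.
by rewrite derive_val; ring.
Qed.

Lemma dx_sqr_F j : {in D, dx j (sqr F) =1 fun p =>
  2 * f (X p) * derive1 f (X p) * (Q p * J p) * delta j ord0}.
Proof.
move=> p; rewrite inE => Dp; rewrite /dx.
have := is_derive_sqr_F Dp (delta_mx 0 j, 0).
have z0 i : (0 : 'rV[R]_n.+1) 0 i = 0 by rewrite mxE.
rewrite /= z0 big1 => [|i _]; last by rewrite z0 mulr0.
by rewrite [delta_mx _ _ _ _]mxE eqxx [ord0 == j]eq_sym => H; rewrite derive_val; ring.
Qed.

Lemma half_grad_delta i j : q (delta_mx 0 i) 0 j = C i j.
Proof.
rewrite mxE (bigD1 i) //= big1 => [|k ki]; first by rewrite mxE !eqxx mul1r addr0.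
by rewrite mxE eqxx (negbTE ki) mul0r.
Qed.

(** Coefficients of [core] on du du, on du q + q du and on q q. *)
Definition core00 p : R := ((a ^+ 2 - 1) ^+ 2 * u p ^+ 2
  + 4 * a * (a ^+ 2 - 1) * u p * w p + (5 * a ^+ 2 - 1) * w p ^+ 2) / Q p.
Definition core01 p : R := 2 * a * w p / Q p.
Definition core11 p : R := - (2 * a * u p) / (Q p * w p).

Definition core p : 'M[R]_n.+1 := \matrix_(i, j)
  (core00 p * (delta i ord0 * delta j ord0)
   + core01 p * (delta i ord0 * q p.2 0 j + q p.2 0 i * delta j ord0)
   + core11 p * (q p.2 0 i * q p.2 0 j) + C i j).

Lemma is_derive_dy_sqr_F p (Dp : D p) j v :
  is_derive p v (dy j (sqr F))
   (2 * f (X p) * J p * (2 * derive1 f (X p) * X v *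
      (((a ^+ 2 - 1) * u p + 2 * a * w p) * delta j ord0 + q p.2 0 j)
    + f (X p) * (2 * a / Q p * (w p * u v - u p * ((\sum_i q p.2 0 i * v.2 0 i) / w p)) *
      (((a ^+ 2 - 1) * u p + 2 * a * w p) * delta j ord0 + q p.2 0 j)
      + ((a ^+ 2 - 1) * u v + 2 * a * ((\sum_i q p.2 0 i * v.2 0 i) / w p)) * delta j ord0
      + q v.2 0 j))).
Proof.
have E : \forall r \near p, 2 * f (X (r : V)) ^+ 2 * (J r *
   (((a ^+ 2 - 1) * u r + 2 * a * w r) * delta j ord0 + q r.2 0 j)) = dy j (sqr F) r.
  apply: (open_eq_near dom_ab_open) => // r Dr.
  by rewrite dy_sqr_F.
apply: (near_eq_is_derive E).
have Hf := is_derive_f Dp v.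
have HJ := is_derive_ratio Dp v.
have Hu := is_derive_u p v; have Hw := is_derive_w Dp v.
have Hq := is_derive_half_grad c j p v.
have [f0 w0 Ap Bp] := dom_pos Dp; have Q0 := quad_gt0 Dp.
derive_rules.
field; rewrite ?lt0r_neq0 //.
Qed.

Lemma metric_core p : D p ->
  metric_tensor F p = (f (X p) ^+ 2 * J p) *: core p.
Proof.
move=> Dp; apply/matrixP => i j; rewrite [LHS]mxE [RHS]mxE [core p i j]mxE /core00 /core01 /core11.
have := is_derive_dy_sqr_F Dp j (0, delta_mx 0 i).
rewrite Dq_dy u_dy [X ((0, delta_mx 0 i) : V)]/=.
rewrite (_ : (0 : 'rV[R]_n.+1) 0 ord0 = 0); last by rewrite mxE.
rewrite /= half_grad_delta => H; rewrite /dy derive_val.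
have [f0 w0 Ap Bp] := dom_pos Dp; have Q0 := quad_gt0 Dp.
have : Q p != 0 by exact: lt0r_neq0.
have w_neq0 : w p != 0 by exact: lt0r_neq0.
rewrite /quad => Q_neq0.
(* The identity uses q_0 = 0, and the mixed entries agree only once Q is
   expanded. *)
have [->|i0] := eqVneq i ord0; have [->|j0] := eqVneq j ord0;
  rewrite ?half_grad0 ?ext_form0l ?ext_form0r /=.
- by field; apply/andP.
- by field; apply/andP.
- by field; apply/andP.
- by field; apply/andP.
Qed.

Local Notation dq p z := (\sum_i q p.2 0 i * z 0 i).

(** The product stays in the span of du and q up to the term q(z), so linear
    systems for [core] reduce to the two unknowns z_0 and the pairing of q with
    z. *)
Lemma mul_core p z j : (z *m core p) 0 j =
    (core00 p * z 0 ord0 + core01 p * dq p z) * delta j ord0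
  + (core01 p * z 0 ord0 + core11 p * dq p z) * q p.2 0 j + q z 0 j.
Proof.
have -> : z 0 ord0 = \sum_i z 0 i * delta i ord0.
  rewrite (bigD1 ord0) //= big1 => [|i /negbTE->]; last by rewrite mulr0.
  by rewrite mulr1 addr0.
set S1 := \sum_i z 0 i * delta i ord0; set S := dq p z.
transitivity ((core00 p * delta j ord0 + core01 p * q p.2 0 j) * S1
  + (core01 p * delta j ord0 + core11 p * q p.2 0 j) * S + q z 0 j); last by ring.
rewrite mxE [q z 0 j]mxE /S1 /S !big_distrr /= -!big_split /=.
by apply: eq_bigr => i _; rewrite [core p i j]mxE; ring.
Qed.

Lemma core_sym p : (core p)^T = core p.
Proof.
apply/matrixP => i j; rewrite mxE [LHS]mxE [RHS]mxE (ext_form_sym csym j i).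
by ring.
Qed.

Lemma sum_q_y p : D p -> dq p p.2 = w p ^+ 2.
Proof. by move=> Dp; rewrite rho_sqr // phi_half_grad. Qed.

(** Pairing an equation z M = 0 with y leaves a homogeneous 2 x 2 system in z_0
    and S = q . z, of determinant a^2 - 1. Hence both vanish, so q(z) = 0, and
    non-singularity of c concludes. *)
Lemma core_unit p : c \in unitmx -> a ^+ 2 - 1 != 0 -> D p ->
  core p \in unitmx.
Proof.
move=> cu k0 Dp; have [f0 w0 _ _] := dom_pos Dp; have Q0 := quad_gt0 Dp.
rewrite unitmxE unitfE; apply/det0P => -[z z0 zM].
have zMj j := etrans (esym (mul_core p z j)) (congr1 (fun N : 'rV_n.+1 => N 0 j) zM).
pose S := dq p z; pose t := core01 p * z 0 ord0 + core11 p * S.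
have E0 : core00 p * z 0 ord0 + core01 p * S = 0.
  by move: (zMj ord0); rewrite !half_grad0 mxE /= mulr1 mulr0 !addr0.
have Ej j : t * q p.2 0 j + q z 0 j = 0.
  by move: (zMj j); rewrite -/S E0 mul0r add0r [RHS]mxE.
have E1 : t * w p ^+ 2 + S = 0.
  rewrite -sum_q_y // /S (half_gradC csym p.2 z) big_distrr -big_split /=.
  by rewrite big1 // => j _; rewrite mulrA -mulrDl Ej mul0r.
have [zu S0] : z 0 ord0 = 0 /\ S = 0.
  have detE : core00 p * (1 + core11 p * w p ^+ 2) - (core01 p * w p) ^+ 2
      = a ^+ 2 - 1.
    have : Q p != 0 by exact: lt0r_neq0.
    have : w p != 0 by exact: lt0r_neq0.
    rewrite /core00 /core01 /core11 /quad => w_neq0 Q_neq0.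
    by field; apply/andP.
  split; apply: (mulfI k0); rewrite mulr0 -detE.
    transitivity ((1 + core11 p * w p ^+ 2) * (core00 p * z 0 ord0 + core01 p * S)
      - core01 p * (t * w p ^+ 2 + S)); first by rewrite /t; ring.
    by rewrite E0 E1 !mulr0 subrr.
  transitivity (core00 p * (t * w p ^+ 2 + S)
    - core01 p * w p ^+ 2 * (core00 p * z 0 ord0 + core01 p * S));
    first by rewrite /t; ring.
  by rewrite E0 E1 !mulr0 subrr.
have qz l : q z 0 (lift ord0 l) = 0.
  by move: (Ej (lift ord0 l)); rewrite /t zu S0 !mulr0 addr0 mul0r add0r.
case/eqP: z0; apply/rowP => i; rewrite mxE.
case: (unliftP ord0 i) => [l ->|-> //].
pose zr : 'rV[R]_n := \row_l z 0 (lift ord0 l).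
suff /rowP/(_ l) : zr = 0 by rewrite !mxE.
have: zr *m c = 0.
  apply/rowP => m; rewrite mxE [RHS]mxE -[RHS](qz m) half_grad_lift.
  by apply: eq_bigr => k _; rewrite mxE.
by move/(congr1 (mulmxr (invmx c))); rewrite /= mul0mx mulmxK.
Qed.

Lemma metric_unit p : c \in unitmx -> a ^+ 2 - 1 != 0 -> D p ->
  metric_tensor F p \in unitmx.
Proof.
move=> cu k0 Dp; rewrite metric_core // unitmxZ ?core_unit //.
have [f0 _ _ _] := dom_pos Dp.
by rewrite unitfE lt0r_neq0 // mulr_gt0 ?ratio_gt0 // exprn_gt0.
Qed.

(** The kernel vector z has z_0 = w and z_m = - 2 a y^m for the other
    coordinates. *)
Lemma metric_singular : a ^+ 2 = 1 -> singular D F.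
Proof.
move=> a1 p Dp; have [f0 w0 _ _] := dom_pos Dp; have Q0 := quad_gt0 Dp.
rewrite metric_core // detZ (_ : \det (core p) = 0) ?mulr0 //.
apply/eqP/det0P.
pose z : 'rV[R]_n.+1 := (w p + 2 * a * u p) *: delta_mx 0 ord0 - (2 * a) *: p.2.
have zu : z 0 ord0 = w p by rewrite !mxE /=; ring.
have zl l : z 0 (lift ord0 l) = - (2 * a) * p.2 0 (lift ord0 l).
  by rewrite !mxE /=; ring.
exists z.
  by apply/negP => /eqP/rowP/(_ ord0)/eqP; rewrite zu mxE gt_eqF.
have Sz : dq p z = - (2 * a) * w p ^+ 2.
  rewrite -sum_q_y // !sum_half_grad big_distrr.
  by apply: eq_bigr => l _; rewrite zl /=; ring.
have qz j : q z 0 j = - (2 * a) * q p.2 0 j.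
  case: (unliftP ord0 j) => [l ->|->]; last by rewrite !half_grad0 mulr0.
  rewrite !half_grad_lift big_distrr; apply: eq_bigr => m _ /=.
  by rewrite zl mulrA.
have : Q p != 0 by exact: lt0r_neq0.
have : w p != 0 by exact: lt0r_neq0.
move=> w_neq0 Q_neq0; have k0 : a ^+ 2 - 1 = 0 by rewrite a1 subrr.
have c0 : core00 p * w p + core01 p * (- (2 * a) * w p ^+ 2) = 0.
  transitivity ((a ^+ 2 - 1) / Q p * ((a ^+ 2 - 1) * u p ^+ 2 * w p
    + 4 * a * u p * w p ^+ 2 + w p ^+ 3)); last by rewrite k0 !mul0r.
  by rewrite /core00 /core01; field.
have c1 : core01 p * w p + core11 p * (- (2 * a) * w p ^+ 2) + (- (2 * a)) = 0.
  transitivity ((a ^+ 2 - 1) / Q p * (- (2 * a) * u p ^+ 2)); last first.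
    by rewrite k0 !mul0r.
  by move: Q_neq0; rewrite /core01 /core11 /quad => ?; field; apply/andP.
apply/rowP => j; rewrite mul_core zu Sz qz c0 mul0r add0r -mulrDl c1 mul0r.
by rewrite mxE.
Qed.

(** * The geodesic spray *)

Lemma dx_dy_sqr_F p r h : D p -> dx r (dy h (sqr F)) p =
  4 * f (X p) * derive1 f (X p) * J p *
  (((a ^+ 2 - 1) * u p + 2 * a * w p) * delta h ord0 + q p.2 0 h) * delta r ord0.
Proof.
move=> Dp; rewrite /dx; have := is_derive_dy_sqr_F Dp h (delta_mx 0 r, 0).
have z0 i : (0 : 'rV[R]_n.+1) 0 i = 0 by rewrite mxE.
rewrite /= z0 big1 => [|i _]; last by rewrite z0 mulr0.
rewrite /half_grad mul0mx z0 -/(half_grad c _).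
rewrite [delta_mx _ _ _ _]mxE eqxx [ord0 == r]eq_sym => H.
by rewrite derive_val; ring.
Qed.

Definition dlogf p : R := derive1 f (X p) / f (X p).
Local Notation g := dlogf.
Local Notation kappa := (a / (a ^+ 2 - 1)).

(** The expected coefficients, as P y corrected in the direction ord0; in this
    shape their pairing with [core] is computed by linearity. *)
Definition spray_row p : 'rV[R]_n.+1 :=
  g p *: ((u p + kappa * w p) *: p.2
   + (((u p ^+ 2 - w p ^+ 2 / (a ^+ 2 - 1)) / 2
       - (u p + kappa * w p) * u p) *: delta_mx 0 ord0)).

Lemma spray_row0 p : spray_row p 0 ord0 =
  g p * ((u p ^+ 2 - w p ^+ 2 / (a ^+ 2 - 1)) / 2).
Proof. by rewrite !mxE /=; ring. Qed.

Lemma spray_row_lift p l : spray_row p 0 (lift ord0 l) =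
  g p *
    ((u p + kappa * w p) * p.2 0 (lift ord0 l)).
Proof. by rewrite !mxE /=; ring. Qed.

(** The left-hand side is the covector that [spray] multiplies by the inverse of
    the metric. Its components on du and on q give two scalar identities in u
    and w. *)
Lemma spray_row_metric p h : a ^+ 2 - 1 != 0 -> D p ->
  \sum_r (p.2 0 r * dx r (dy h (sqr F)) p) - dx h (sqr F) p =
  4 * (spray_row p *m metric_tensor F p) 0 h.
Proof.
move=> k0 Dp; have [f0 w0 _ _] := dom_pos Dp; have Q0 := quad_gt0 Dp.
pose P := g p * (u p + kappa * w p).
have SG : dq p (spray_row p) = P * w p ^+ 2.
  rewrite -sum_q_y // !sum_half_grad big_distrr.
  by apply: eq_bigr => l _; rewrite spray_row_lift /P /=; ring.
have qG j : q (spray_row p) 0 j = P * q p.2 0 j.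
  case: (unliftP ord0 j) => [l ->|->]; last by rewrite !half_grad0 mulr0.
  rewrite !half_grad_lift big_distrr; apply: eq_bigr => m _ /=.
  by rewrite spray_row_lift /P; ring.
rewrite metric_core // -scalemxAr [in RHS]mxE mul_core SG qG spray_row0.
rewrite (eq_bigr (fun r => 4 * f (X p) * derive1 f (X p) * J p *
  (((a ^+ 2 - 1) * u p + 2 * a * w p) * delta h ord0 + q p.2 0 h) *
  (p.2 0 r * delta r ord0))); last first.
  by move=> r _; rewrite dx_dy_sqr_F //; ring.
rewrite -big_distrr /= (bigD1 ord0) //= big1 => [|i /negbTE->]; last by rewrite mulr0.
rewrite dx_sqr_F ?inE // addr0 mulr1.
have : Q p != 0 by exact: lt0r_neq0.
have f_neq0 : f (X p) != 0 by exact: lt0r_neq0.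
have : w p != 0 by exact: lt0r_neq0.
rewrite /core00 /core01 /core11 /P /dlogf /quad => w_neq0 Q_neq0.
field; rewrite ?f_neq0 ?w_neq0 ?k0 //.
Qed.

Lemma spray_F p i : c \in unitmx -> a ^+ 2 - 1 != 0 -> D p ->
  spray F i p = spray_row p 0 i.
Proof.
move=> cu k0 Dp; have gu := metric_unit cu k0 Dp.
rewrite /spray (eq_bigr (fun h => 4 * ((spray_row p *m metric_tensor F p) 0 h
  * invmx (metric_tensor F p) h i))); last first.
  move=> h _; rewrite spray_row_metric //.
  have -> : invmx (metric_tensor F p) i h = invmx (metric_tensor F p) h i.
    have: (metric_tensor F p)^T = metric_tensor F p.
      by rewrite metric_core // linearZ /= core_sym.
    by move/(congr1 invmx); rewrite -trmx_inv => /matrixP/(_ h i); rewrite mxE.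
  by ring.
rewrite -big_distrr /= mulKf ?pnatr_eq0 //.
have := mulmxK gu (spray_row p) => /rowP/(_ i) <-.
by rewrite [RHS]mxE.
Qed.

Lemma spray_F_1 p : c \in unitmx -> a ^+ 2 - 1 != 0 -> D p ->
  spray F ord0 p = spray_1 f c a p.
Proof.
move=> cu k0 Dp; have [f0 w0 _ _] := dom_pos Dp.
have [Up phi0 _ _] := (dom_abE p).1 Dp.
rewrite spray_F // spray_row0 /dlogf /spray_1 rho_sqr //.
have -> : alpha f c p ^+ 2 = f (X p) ^+ 2 * (u p ^+ 2 + phi c p.2).
  by rewrite -[LHS](subrK (beta f p ^+ 2)) alphabeta_phi // /beta; ring.
rewrite /beta; have f_neq0 : f (X p) != 0 by exact: lt0r_neq0.
by field; apply/andP.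
Qed.

Lemma spray_F_lift p m : c \in unitmx -> a ^+ 2 - 1 != 0 -> D p ->
  spray F (lift ord0 m) p = spray_P f c a p * p.2 0 (lift ord0 m).
Proof.
move=> cu k0 Dp; have [f0 w0 _ _] := dom_pos Dp.
have [Up phi0 _ _] := (dom_abE p).1 Dp.
rewrite spray_F // spray_row_lift /dlogf /spray_P radicalE //.
have f_neq0 : f (X p) != 0 by exact: lt0r_neq0.
by field; apply/andP.
Qed.

(** * The Berwald and Landsberg tensors *)

Lemma dy_eq (G H : V -> R) p i d : {in D, G =1 H} -> D p ->
  is_derive p (0, delta_mx 0 i) H d -> dy i G p = d.
Proof.
move=> GH Dp hH; rewrite /dy (open_eq_derive _ dom_ab_open GH) ?inE //.
exact: derive_val.
Qed.

(** The Hessian of w, written with the inverse of w so that it can be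
    differentiated without new denominators. *)
Definition hess j k p : R := (w p)^-1 * (C j k - q p.2 0 j * q p.2 0 k * (w p)^-1 ^+ 2).

Lemma dy_facts p i (v := (0, delta_mx 0 i) : V) : D p ->
  [/\ is_derive p v (fun r => u r) (delta i ord0),
      is_derive p v w (q p.2 0 i / w p),
      is_derive p v (fun r => (w r)^-1) (- (q p.2 0 i / w p) / w p ^+ 2),
      forall j, is_derive p v (fun r => r.2 0 j) (delta i j) &
      forall j, is_derive p v (fun r => q r.2 0 j) (C i j)].
Proof.
move=> Dp; have [f0 w0 _ _] := dom_pos Dp.
have Hw : is_derive p v w (q p.2 0 i / w p).
  by have := is_derive_w Dp v; rewrite Dq_dy.
split=> //.
- by rewrite -u_dy; exact: is_derive_u.
- by apply: is_deriveVE => //; exact: lt0r_neq0.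
- move=> j; have := is_derive_y j p v.
  by rewrite /= [delta_mx _ _ _ _]mxE eqxx eq_sym.
- by move=> j; have := is_derive_half_grad c j p v; rewrite half_grad_delta.
Qed.

Lemma is_derive_g p i : is_derive p (0, delta_mx 0 i) g 0.
Proof. exact: (is_derive_base (fun x : 'rV[R]_n.+1 => derive1 f (x 0 ord0) / f (x 0 ord0))). Qed.

Hypothesis cu : c \in unitmx.
Hypothesis k0 : a ^+ 2 - 1 != 0.

Lemma dy_spray k m : {in D, dy k (spray F (lift ord0 m)) =1 fun p =>
  g p * ((delta k ord0 + kappa * (q p.2 0 k * (w p)^-1)) * p.2 0 (lift ord0 m)
         + (u p + kappa * w p) * delta k (lift ord0 m))}.
Proof.
move=> p; rewrite inE => Dp.
apply: (@dy_eq _ (fun r => g r * ((u r + kappa * w r) * r.2 0 (lift ord0 m)))) => //.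
  by move=> r; rewrite inE => Dr; rewrite spray_F // spray_row_lift.
have [Hu Hw _ /(_ (lift ord0 m)) Hy _] := dy_facts k Dp.
have Hg := is_derive_g p k.
by derive_rules; ring.
Qed.

Lemma dy_dy_spray j k m : {in D, dy j (dy k (spray F (lift ord0 m))) =1 fun p =>
  g p * (kappa * hess j k p * p.2 0 (lift ord0 m)
    + (delta k ord0 + kappa * (q p.2 0 k * (w p)^-1)) * delta j (lift ord0 m)
    + (delta j ord0 + kappa * (q p.2 0 j * (w p)^-1)) * delta k (lift ord0 m))}.
Proof.
move=> p; rewrite inE => Dp.
apply: (dy_eq (dy_spray k m)) => //.
have [Hu Hw Hr /(_ (lift ord0 m)) Hy /(_ k) Hq] := dy_facts j Dp.
have Hg := is_derive_g p j; have [_ w0 _ _] := dom_pos Dp.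
by rewrite /hess; derive_rules; field; rewrite ?k0 lt0r_neq0.
Qed.

(** The third derivatives of w, that is, the derivative of [hess j k] along the
    i-th coordinate. *)
Definition dhess i j k p : R := (w p)^-1 ^+ 3 *
  (3 * q p.2 0 i * q p.2 0 j * q p.2 0 k * (w p)^-1 ^+ 2
   - C j k * q p.2 0 i - C i j * q p.2 0 k - C i k * q p.2 0 j).

(** These are the third derivatives of w y^m, by Leibniz: the terms in u y^m are
    quadratic and disappear. *)
Lemma berwald_lift m i j k p : D p -> berwald_tensor F (lift ord0 m) i j k p =
  g p * kappa * (dhess i j k p * p.2 0 (lift ord0 m)
    + hess j k p * delta i (lift ord0 m) + hess i k p * delta j (lift ord0 m)
    + hess i j p * delta k (lift ord0 m)).
Proof.
move=> Dp; apply: (dy_eq (dy_dy_spray j k m)) => //.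
have [Hu Hw Hr /(_ (lift ord0 m)) Hy Hq] := dy_facts i Dp.
have Hqj := Hq j; have Hqk := Hq k.
have Hg := is_derive_g p i; have [_ w0 _ _] := dom_pos Dp.
by rewrite /hess /dhess; derive_rules; field; rewrite ?k0 lt0r_neq0.
Qed.

(** G^1 is quadratic in y. *)
Lemma berwald_0 i j k p : D p -> berwald_tensor F ord0 i j k p = 0.
Proof.
move=> Dp.
have D1 : {in D, dy k (spray F ord0) =1 fun p => g p * (u p * delta k ord0
    - (a ^+ 2 - 1)^-1 * q p.2 0 k)}.
  move=> r; rewrite inE => Dr.
  apply: (@dy_eq _ (fun r => g r * ((u r ^+ 2 + (-1) * (a ^+ 2 - 1)^-1 * w r ^+ 2) * 2^-1))) => //.
    by move=> s; rewrite inE => Ds; rewrite spray_F // spray_row0; field; rewrite k0.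
  have [Hu Hw _ _ _] := dy_facts k Dr; have Hg := is_derive_g r k.
  have [_ w0 _ _] := dom_pos Dr.
  by derive_rules; field; rewrite ?k0 lt0r_neq0.
have D2 : {in D, dy j (dy k (spray F ord0)) =1 fun p => g p * (delta j ord0 * delta k ord0
    - (a ^+ 2 - 1)^-1 * C j k)}.
  move=> r; rewrite inE => Dr; apply: (@dy_eq _ (fun p => g p * (u p * delta k ord0
    + (-1) * (a ^+ 2 - 1)^-1 * q p.2 0 k))) => //.
    by move=> s sD; rewrite D1 //; ring.
  have [Hu _ _ _ /(_ k) Hq] := dy_facts j Dr; have Hg := is_derive_g r j.
  by derive_rules; ring.
apply: (dy_eq D2) => //; have Hg := is_derive_g p i.
by derive_rules; ring.
Qed.

(** Since q = w dw and q . y = w^2, the contraction is, up to kappa f'/f, w times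
    w w_ijk + w_i w_jk + w_j w_ik + w_k w_ij, which is w/2 times the third
    derivative of the quadratic function w^2. *)
Lemma contraction_berwald i j k p : D p ->
  \sum_m q p.2 0 (lift ord0 m) * berwald_tensor F (lift ord0 m) i j k p = 0.
Proof.
move=> Dp; have [_ w0 _ _] := dom_pos Dp.
have Sdelta s : \sum_m q p.2 0 (lift ord0 m) * delta s (lift ord0 m) = q p.2 0 s.
  pose e : 'rV[R]_n.+1 := delta_mx 0 s.
  transitivity (dq p e); last exact: Dq_dy.
  rewrite sum_half_grad; apply: eq_bigr => m _.
  by rewrite [e _ _]mxE eqxx eq_sym.
transitivity (g p * kappa * (dhess i j k p * w p ^+ 2 + hess j k p * q p.2 0 i
  + hess i k p * q p.2 0 j + hess i j p * q p.2 0 k)).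
  rewrite -sum_q_y // sum_half_grad -!Sdelta !big_distrr -!big_split /= big_distrr.
  by apply: eq_bigr => m _; rewrite berwald_lift //=; ring.
by rewrite /hess /dhess; field; rewrite lt0r_neq0.
Qed.

(** * The metric is Landsberg but not Berwald *)

Lemma elementary_F : elementary D F.
Proof.
have Dphi p : D p -> 0 < phi c p.2 by move=> /dom_abE[].
have ew := elementary_rho Dphi.
have eA k : elementary D (factor k).
  apply: elementaryD => //.
  by apply: elementaryM; [exact: elementary_cst|exact: elementary_y].
have ef : elementary D (fun p => f (X p)).
  apply: (@elementary_comp _ _ D nat (fun k => derive1n k f) (fun=> 1) S _ 0%N).
    exact: elementary_x.
  move=> k p /dom_abE[Up _ _ _]; rewrite mul1r derive1nS derive1E.
  by apply: derivableP; exact: fsmooth.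
apply: elementary_eq (_ : elementary D (fun p =>
  f (X p) * (A p `^ ((1 + a) / 2) * B p `^ ((1 - a) / 2)))) _.
  by apply: elementaryM => //; apply: elementaryM; apply: elementary_powR => // p Dp;
    have [_ _ ? ?] := dom_pos Dp.
by move=> p; rewrite inE => Dp; rewrite F_abE.
Qed.

Lemma landsberg_F : landsberg D F.
Proof.
move=> p Dp i j k; have [f0 w0 _ _] := dom_pos Dp.
have FdF h : F p * dy h F p = f (X p) ^+ 2 * J p *
    (((a ^+ 2 - 1) * u p + 2 * a * w p) * delta h ord0 + q p.2 0 h).
  have dF : is_derive p (0, delta_mx 0 h) F (dy h F p).
    apply: derivableP; apply: diff_derivable.
    exact: (elementary_differentiable dom_ab_open elementary_F).
  have : dy h (sqr F) p = 2 * (F p * dy h F p).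
    by rewrite mulrA; apply: derive_val; exact: is_derive_sqrE.
  rewrite dy_sqr_F ?inE // => E; apply: (mulfI (_ : 2 != 0)) => //.
  by rewrite -E; ring.
(* Stated over arbitrary scalars: rewriting with the actual tensors makes
   unification unfold F. *)
have gen (x K L : R) (d b e : 'I_n.+1 -> R) :
    (forall h, x * d h = K * (L * delta h ord0 + e h)) -> b ord0 = 0 ->
    \sum_m e (lift ord0 m) * b (lift ord0 m) = 0 -> x * \sum_h d h * b h = 0.
  move=> xd b0 eb0; rewrite big_ord_recl b0 mulr0 add0r big_distrr /=.
  rewrite (eq_bigr (fun m => K * (e (lift ord0 m) * b (lift ord0 m)))).
    by rewrite -big_distrr eb0 /= mulr0.
  by move=> m _ /=; rewrite mulrA xd /=; ring.
rewrite /landsberg_tensor -mulrA.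
have := gen _ _ _ (fun h => dy h F p) (fun h => berwald_tensor F h i j k p)
  (fun h => q p.2 0 h) FdF (berwald_0 i j k Dp) (contraction_berwald i j k Dp).
by move=> ->; rewrite mulr0.
Qed.

(** w is homogeneous of degree 1 in the n coordinates other than ord0, so its
    third derivatives contracted with y give minus its Hessian. The three terms
    with a Kronecker symbol contribute n + 2 Hessians. *)
Lemma trace_berwald l m p : D p ->
  \sum_h berwald_tensor F (lift ord0 h) (lift ord0 h) (lift ord0 l) (lift ord0 m) p
  = n.+1%:R * (g p * kappa) * hess (lift ord0 l) (lift ord0 m) p.
Proof.
move=> Dp; have [_ w0 _ _] := dom_pos Dp.
set j := lift ord0 l; set k := lift ord0 m.
have Sy : \sum_h q p.2 0 (lift ord0 h) * p.2 0 (lift ord0 h) = w p ^+ 2.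
  by rewrite -sum_half_grad sum_q_y.
have SC s : \sum_h C (lift ord0 h) s * p.2 0 (lift ord0 h) = q p.2 0 s.
  rewrite [RHS]mxE big_ord_recl ext_form0l mulr0 add0r.
  by apply: eq_bigr => h _; rewrite mulrC.
have Sdelta s (x : 'I_n -> R) : \sum_h x h * delta (lift ord0 s) (lift ord0 h) = x s.
  rewrite (bigD1 s) //= big1 => [|h hs]; first by rewrite eqxx mulr1 addr0.
  by rewrite (inj_eq lift_inj) eq_sym (negbTE hs) mulr0.
have Shess : \sum_h dhess (lift ord0 h) j k p * p.2 0 (lift ord0 h) = - hess j k p.
  transitivity ((w p)^-1 ^+ 3 * ((3 * q p.2 0 j * q p.2 0 k * (w p)^-1 ^+ 2 - C j k) * w p ^+ 2
     - q p.2 0 k * q p.2 0 j - q p.2 0 j * q p.2 0 k)); last first.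
    by rewrite /hess; field; rewrite lt0r_neq0.
  pose K := 3 * q p.2 0 j * q p.2 0 k * (w p)^-1 ^+ 2 - C j k.
  rewrite -/K -Sy; transitivity ((w p)^-1 ^+ 3 *
    (K * (\sum_h q p.2 0 (lift ord0 h) * p.2 0 (lift ord0 h))
     - q p.2 0 k * (\sum_h C (lift ord0 h) j * p.2 0 (lift ord0 h))
     - q p.2 0 j * (\sum_h C (lift ord0 h) k * p.2 0 (lift ord0 h))));
    last by rewrite !SC.
  rewrite !big_distrr -!sumrB big_distrr; apply: eq_bigr => h _ /=.
  by rewrite /dhess /K; ring.
rewrite (eq_bigr (fun h => g p * kappa * (dhess (lift ord0 h) j k p * p.2 0 (lift ord0 h)
    + hess j k p + hess (lift ord0 h) k p * delta j (lift ord0 h)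
    + hess (lift ord0 h) j p * delta k (lift ord0 h)))); last first.
  by move=> h _; rewrite berwald_lift // eqxx mulr1.
rewrite -big_distrr !big_split /= Shess.
rewrite (Sdelta l (fun h => hess (lift ord0 h) k p)).
rewrite (Sdelta m (fun h => hess (lift ord0 h) j p)) -/k -/j.
rewrite (_ : hess k j p = hess j k p); last first.
  by rewrite /hess (ext_form_sym csym j k); ring.
by rewrite sumr_const card_ord -mulr_natr -natr1; ring.
Qed.

(** If the Hessian of w vanishes, then w^2 c_lm = q_l q_m, which has rank at most
    1. *)
Lemma not_berwald_F p : (1 < n)%N -> a != 0 -> D p -> derive1 f (X p) != 0 ->
  ~ berwald D F.
Proof.
move=> n1 a0 Dp f'0 bF; have [f0 w0 _ _] := dom_pos Dp.
have gk0 : g p * kappa != 0.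
  by rewrite !mulf_neq0 ?invr_neq0 // lt0r_neq0.
have hess0 l m : hess (lift ord0 l) (lift ord0 m) p = 0.
  apply: (mulfI (mulf_neq0 (_ : n.+1%:R != 0) gk0)); first by rewrite pnatr_eq0.
  rewrite mulr0 -trace_berwald // big1 // => h _.
  exact: bF.
pose e : 'rV[R]_n := \row_l q p.2 0 (lift ord0 l).
have cE : c = (w p) ^- 2 *: (e^T *m e).
  apply/matrixP => l m; rewrite mxE [(_ *m _) _ _]mxE big_ord1 [_^T _ _]mxE ![e _ _]mxE -ext_formE.
  have /eqP := hess0 l m.
  rewrite mulf_eq0 invr_eq0 gt_eqF //= subr_eq0 => /eqP ->.
  by rewrite exprVn mulrC.
have := mulmx_max_rank e^T e.
have : \rank c = n by apply/eqP; rewrite -[_ == _]/(row_free c) row_free_unit.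
rewrite {1}cE mxrank_scale_nz; last by rewrite invr_eq0 expf_neq0 // lt0r_neq0.
by move=> ->; rewrite leqNgt n1.
Qed.

(** * Finsler property and the Riemannian case *)

Hypothesis U0 : exists x : 'rV[R]_n.+1, U x.
Hypothesis cpos : exists y : 'rV[R]_n.+1, 0 < phi c y.

(** phi does not see y^1, so the vector may be taken with u = 0, where both bases
    reduce to w > 0. *)
Lemma dom_over x : U x -> exists2 p, D p & p.1 = x.
Proof.
move=> Ux; have [y y0] := cpos.
pose z : 'rV[R]_n.+1 := y - y 0 ord0 *: delta_mx 0 ord0.
have phiz : phi c z = phi c y by apply: phi_lift => l; rewrite !mxE /=; ring.
exists (x, z) => //; apply/dom_abE.
have zu : z 0 ord0 = 0 by rewrite !mxE /=; ring.
by split; rewrite /factor /rho /= ?zu ?mulr0 ?add0r ?sqrtr_gt0 ?phiz.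
Qed.

Lemma finsler_metric_F : finsler_metric D F.
Proof.
have scale p t : 0 < t -> w (p.1, t *: p.2) = t * w p.
  by move=> t0; rewrite /rho phiZ sqrtrM ?sqr_ge0 // sqrtr_sqr gtr0_norm.
have fscale k p t : 0 < t -> factor k (p.1, t *: p.2) = t * factor k p.
  by move=> t0; rewrite /factor scale //= mxE; ring.
have Dscale p t : 0 < t -> D p -> D (p.1, t *: p.2).
  move=> t0 /dom_abE[Up phi0 Ap Bp]; apply/dom_abE.
  by rewrite !fscale // phiZ !pmulr_rgt0 // exprn_gt0.
split.
- split; first exact: dom_ab_open.
  + by have [x /dom_over[p Dp _]] := U0; exists p.
  + by move=> p t; exact: Dscale.
  + move=> p /dom_abE[_ phi0 _ _]; apply: contraTneq phi0 => ->.
    by have := phiZ c 0 (0 : 'rV[R]_n.+1); rewrite scale0r expr0n mul0r => ->; rewrite ltxx.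
- exact: (elementary_smooth dom_ab_open elementary_F).
- move=> p t t0 Dp; have [f0 w0 Ap Bp] := dom_pos Dp.
  rewrite (F_abE Dp) (F_abE (Dscale _ _ t0 Dp)) !fscale // !powRM ?ltW //= mulrACA -powRD.
    rewrite (_ : (1 + a) / 2 + (1 - a) / 2 = 1); last by field.
    by rewrite powRr1 ?ltW //; ring.
  by rewrite lt0r_neq0 ?implybT.
- move=> p Dp; have [f0 w0 Ap Bp] := dom_pos Dp.
  by rewrite F_abE // lt0r_neq0 // !mulr_gt0 ?powR_gt0.
- by move=> p Dp; exact: metric_unit.
Qed.

(** For a = 0, Q = w^2 - u^2 and the powers in J have exponent 0. *)
Lemma riemannian_F : a = 0 -> riemannian D F.
Proof.
move=> a0; split; first exact: finsler_metric_F.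
exists (fun x => f (x 0 ord0) ^+ 2 *: (C - delta_mx ord0 ord0)); split.
  move=> x; rewrite linearZ linearB /= trmx_delta; congr (_ *: (_ - _)).
  by apply/matrixP => i j; rewrite mxE (ext_form_sym csym).
move=> p Dp; rewrite -[LHS]/(sqr F p) sqr_F_abE // /ratio a0 oppr0 !powRr0.
pose e := (delta_mx ord0 ord0 : 'M[R]_n.+1).
have Se : \sum_i \sum_j e i j * p.2 0 i * p.2 0 j = u p ^+ 2.
  rewrite (bigD1 ord0) //= (bigD1 ord0) //= !big1 => [|i i0|i i0].
  - by rewrite mxE /= !addr0; ring.
  - by rewrite big1 // => j _; rewrite mxE (negbTE i0) !mul0r.
  - by rewrite mxE (negbTE i0) andbF !mul0r.
have SC : \sum_i \sum_j C i j * p.2 0 i * p.2 0 j = w p ^+ 2.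
  rewrite -sum_q_y // exchange_big; apply: eq_bigr => j _ /=.
  rewrite [q p.2 0 j]mxE big_distrl; apply: eq_bigr => i _ /=; ring.
have ME i j : (f (X p) ^+ 2 *: (C - e)) i j = f (X p) ^+ 2 * (C i j - e i j).
  by rewrite mxE [(C - e) i j]mxE [(- e) i j]mxE.
rewrite /quad a0; transitivity (f (X p) ^+ 2 * (w p ^+ 2 - u p ^+ 2)).
  by rewrite !mulr1; ring.
rewrite -SC -Se -sumrB big_distrr; apply: eq_bigr => i _ /=.
rewrite -sumrB big_distrr; apply: eq_bigr => j _ /=.
by rewrite ME; ring.
Qed.

End Metric.

Theorem theorem4p7 (R : realType) (n : nat) (hn : (3 <= n.+1)%N)
    (U : set 'rV[R]_n.+1) (hU : open U)
    (f : R -> R)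
    (fsmooth : forall x : 'rV[R]_n.+1, U x ->
       forall k : nat, derivable (derive1n k f) (x 0 ord0) 1)
    (fpos : forall x : 'rV[R]_n.+1, U x -> 0 < f (x 0 ord0))
    (fnc : exists x : 'rV[R]_n.+1, U x /\ derive1 f (x 0 ord0) != 0)
    (c : 'M[R]_n) (csym : c^T = c) (cns : c \in unitmx)
    (cpos : exists y : 'rV[R]_n.+1, 0 < phi c y)
    (a : R) :
  [/\ (a != 0 -> a != 1 -> a != -1 ->
         [/\ finsler_metric (dom_ab f c a U) (F_ab f c a),
             landsberg (dom_ab f c a U) (F_ab f c a),
             ~ berwald (dom_ab f c a U) (F_ab f c a),
             (forall p, dom_ab f c a U p ->
                spray (F_ab f c a) ord0 p = spray_1 f c a p)
           & (forall p, dom_ab f c a U p -> forall m : 'I_n,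
                spray (F_ab f c a) (lift ord0 m) p
                = spray_P f c a p * p.2 0 (lift ord0 m))]),
      (a = 0 -> riemannian (dom_ab f c a U) (F_ab f c a))
    & (a = 1 \/ a = -1 -> singular (dom_ab f c a U) (F_ab f c a))].
Proof.
have [x [Ux f'x]] := fnc.
have U0 : exists x, U x by exists x.
split=> [a0 a1 aN1|a0|a1].
- have k0 : a ^+ 2 - 1 != 0.
    by rewrite subr_eq0 sqrf_eq1 negb_or a1.
  split.
  + exact: finsler_metric_F.
  + exact: landsberg_F.
  + have [p Dp px] := dom_over a fpos cpos Ux.
    by apply: not_berwald_F Dp _ => //; rewrite px.
  + by move=> p Dp; apply: (spray_F_1 (U := U)).
  + by move=> p Dp m; apply: (spray_F_lift (U := U)).
- apply: riemannian_F => //.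
  by rewrite a0 expr0n sub0r oppr_eq0 oner_eq0.
- apply: metric_singular => //.
  by case: a1 => ->; rewrite ?sqrrN expr1n.
Qed.
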